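(* Let $n,m\ge 2$ be integers, let $G=K_n\,\square\,K_m$, and let $k$ be an integer with $1\le k\le\kappa(G)$. Consider the integer linear program $F_{gh}$ in the variables $s_u$ ($u\in V(G)$), $h_j$ ($j\in\mathbb{Z}_m$), $g_i$ ($i\in\mathbb{Z}_n$): $$\begin{aligned} \min\ & \sum_{u\in V(G)}s_u\\ \text{s.t. } & h_j=\sum_{u\in V(K_n^j)}s_u && j\in\mathbb{Z}_m && (1)\\ & g_i=\sum_{u\in V({}^iK_m)}s_u && i\in\mathbb{Z}_n && (2)\\ & h_j+h_{j'}\ge k && j,j'\in\mathbb{Z}_m,\ j\neq j' && (3)\\ & g_i+g_{i'}\ge k && i,i'\in\mathbb{Z}_n,\ i\neq i' && (4)\\ & h_{j_u}+h_{j_v}+g_{i_u}+g_{i_v}-2s_{\tilde u}-2s_{\tilde v}\ge k && u,v\in V(G)\text{ distinct, not aligned} && (5)\\ & s_u\in\{0,1\} && u\in V(G)\\ & h_j,\,g_i\in\mathbb{Z} && j\in\mathbb{Z}_m,\ i\in\mathbb{Z}_n, \end{aligned}$$ where $u=(i_u,j_u)$, $v=(i_v,j_v)$, $\tilde u=(i_u,j_v)$, $\tilde v=(i_v,j_u)$, and in (3), (4), (5) there is one constraint for each unordered pair. Then: (a) $F_{gh}$ produces a weak $k$-metric basis of $G$: it has an optimal solution, and for every optimal solution the set $S=\{u\in V(G): s_u=1\}$ is a weak $k$-metric basis of $G$. (b) $F_{gh}$ has $m$ constraints (1) and $n$ constraints (2); the numbers of constraints (3) and (4) are $O(m^2)$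 and $O(n^2)$, respectively; and the number of constraints (5) is $O(n^2m^2)$. The constraints (5) are only needed when $k\le 3$, i.e. for $k\ge 4$ they may be omitted without changing the set of feasible solutions. (c) For $k\ge 4$, the constraints of $F_{gh}$ on $S=\{u: s_u=1\}$ amount to the following: every pair of distinct vertical layers must contain (in total) at least $k$ elements of $S$, and every pair of distinct horizontal layers must contain (in total) at least $k$ elements of $S$.
   Context: $K_n\,\square\,K_m$ is the Cartesian product of complete graphs, with vertex set $\mathbb{Z}_n\times\mathbb{Z}_m$; two distinct vertices are adjacent iff they agree in exactly one coordinate. For $i\in\mathbb{Z}_n$, the vertical layer ${}^iK_m$ is the subgraph induced by $\{i\}\times\mathbb{Z}_m$; for $j\in\mathbb{Z}_m$, the horizontal layer $K_n^j$ is the subgraph induced by $\mathbb{Z}_n\times\{j\}$. Two vertices are called aligned if they agree in exactly one coordinate. For a connected finite simple graph $G$, $d_G(a,b)$ is the number of edges on a shortest $a,b$-path, and $\Delta_z(x,y)=|d_G(x,z)-d_G(y,z)|$. For an integer $k\ge 1$, a set $S\subseteq V(G)$ is a weak $k$-resolving set of $G$ if $\sum_{w\in S}\Delta_w(x,y)\ge k$ for every two distinct vertices $x,y\in V(G)$; a weak $k$-metric basis of $G$ is a weak $k$-resolving set of minimum cardinality. $\kappa(G)$ is the largest integer $k$ such that $G$ has a weak $k$-resolving set. *)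

(* Defs.v *)
From HB Require Import structures.
From mathcomp Require Import all_boot all_order all_algebra.
Set Implicit Arguments.
Unset Strict Implicit.
Unset Printing Implicit Defensive.
Import Order.TTheory GRing.Theory Num.Theory.

Local Open Scope nat_scope.

Section WeakMetricDimension.

(* A finite simple graph is a symmetric irreflexive relation [e] on [T]. *)
Variables (T : finType) (e : rel T).
Implicit Types (x y z : T) (S : {set T}) (k l : nat).

Definition has_path l x y : bool :=
  [exists p : l.-tuple T, [&& path e x p, last x p == y & uniq (x :: p)]].

(* A path has fewer than #|T| edges, so the search range is exhaustive; the
   value is #|T| when no path joins x and y. *)
Definition gdist x y : nat := find (fun l => has_path l x y) (iota 0 #|T|).

Definition Delta z x y : nat := `|gdist x z - gdist y z|.

Definition weak_resolving k S : bool :=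
  [forall x, forall y, (x != y) ==> (k <= \sum_(w in S) Delta w x y)].

Definition weak_basis k S : Prop :=
  weak_resolving k S /\
  forall S' : {set T}, weak_resolving k S' -> #|S| <= #|S'|.

(* If #|T| > 1, no set is weak k-resolving for k > #|T| * #|T|, so the bound on
   the range of k is harmless: see [kappaP]. (For #|T| <= 1 every k is
   admissible and kappa is not meaningful.) *)
Definition kappa : nat :=
  \max_(k < (#|T| * #|T|).+1 | [exists S, weak_resolving k S]) k.

Lemma gdist_le x y : gdist x y <= #|T|.
Proof. by rewrite /gdist (leq_trans (find_size _ _)) // size_iota. Qed.

Lemma kappaP : 1 < #|T| ->
  (exists S, weak_resolving kappa S) /\
  (forall k S, weak_resolving k S -> k <= kappa).
Proof.
move=> T1; split=> [|k S rS].
  have r0 : [exists S, weak_resolving 0 S].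
    by apply/existsP; exists set0; apply/forallP=> x; apply/forallP=> y;
       apply/implyP.
  have c0 : 0 < #|[pred k : 'I_(#|T| * #|T|).+1 |
                   [exists S, weak_resolving k S]]|.
    by apply/card_gt0P; exists ord0.
  have [k rk kE] := eq_bigmax_cond (@nat_of_ord _) c0.
  by move: rk; rewrite inE => /existsP[S rS]; exists S; rewrite /kappa kE.
have [x [y xy]] : exists x y, x != y.
  have /card_gt1P[x [y [_ _ xy]]] := T1.
  by exists x, y.
have kle : k <= #|T| * #|T|.
  move/forallP/(_ x)/forallP/(_ y)/implyP/(_ xy): rS => /leq_trans; apply.
  apply: (@leq_trans (\sum_(w in S) #|T|)); last first.
    by rewrite sum_nat_const leq_mul2r max_card orbT.
  apply: leq_sum => w _; rewrite /Delta.
  have := gdist_le x w; have := gdist_le y w.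
  case: (leqP (gdist x w) (gdist y w)) => h hy hx.
    by rewrite distnEr //; apply: leq_trans (leq_subr _ _) hy.
  by rewrite distnEl; [apply: leq_trans (leq_subr _ _) hx | apply: ltnW].
have kP : k < (#|T| * #|T|).+1 by [].
apply: (@leq_bigmax_cond _ (fun i : 'I_(#|T| * #|T|).+1 =>
          [exists S', weak_resolving i S']) (@nat_of_ord _) (Ordinal kP)).
by apply/existsP; exists S.
Qed.

End WeakMetricDimension.

Section RookGraph.

Variables n m : nat.
Implicit Types u v : 'I_n * 'I_m.

Definition aligned u v : bool := (u.1 == v.1) (+) (u.2 == v.2).

(* The rook graph is the Cartesian product of the complete graphs on 'I_n, 'I_m. *)
Definition rook : rel ('I_n * 'I_m) := fun u v => (u != v) && aligned u v.

Lemma rook_irr : irreflexive rook.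
Proof. by move=> u; rewrite /rook eqxx. Qed.

Lemma rook_sym : symmetric rook.
Proof.
by move=> u v; rewrite /rook /aligned eq_sym (eq_sym u.1) (eq_sym u.2).
Qed.

Definition vlayer (i : 'I_n) : {set 'I_n * 'I_m} := [set u | u.1 == i].
Definition hlayer (j : 'I_m) : {set 'I_n * 'I_m} := [set u | u.2 == j].

End RookGraph.

Arguments rook : clear implicits.

(* Exactly one of (x, y), (y, x) for each unordered pair of distinct x, y. *)
Definition upairs (T : finType) : seq (T * T) :=
  [seq p <- enum {: T * T} | enum_rank p.1 < enum_rank p.2].

Local Open Scope ring_scope.

Record assignment (n m : nat) := Assignment {
  s_ : 'I_n * 'I_m -> int;
  h_ : 'I_m -> int;
  g_ : 'I_n -> int
}.

Definition constraint (n m : nat) := assignment n m -> bool.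

Section Program.

Variables (n m k : nat).
Implicit Types a b : assignment n m.

Definition con1 : seq (constraint n m) :=
  [seq (fun a => h_ a j == \sum_(u in hlayer n j) s_ a u) | j <- enum 'I_m].

Definition con2 : seq (constraint n m) :=
  [seq (fun a => g_ a i == \sum_(u in vlayer m i) s_ a u) | i <- enum 'I_n].

Definition con3 : seq (constraint n m) :=
  [seq (fun a => h_ a p.1 + h_ a p.2 >= k%:Z) | p <- upairs 'I_m].

Definition con4 : seq (constraint n m) :=
  [seq (fun a => g_ a p.1 + g_ a p.2 >= k%:Z) | p <- upairs 'I_n].

Definition con5 : seq (constraint n m) :=
  [seq (fun a => let: (u, v) := p in
          h_ a u.2 + h_ a v.2 + g_ a u.1 + g_ a v.1
            - 2 * s_ a (u.1, v.2) - 2 * s_ a (v.1, u.2) >= k%:Z)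
  | p <- upairs ('I_n * 'I_m)%type & ~~ aligned p.1 p.2].

Definition F_gh : seq (constraint n m) := con1 ++ con2 ++ con3 ++ con4 ++ con5.

Definition F_gh_without5 : seq (constraint n m) :=
  con1 ++ con2 ++ con3 ++ con4.

End Program.

Section Solutions.

Variables (n m : nat).
Implicit Types (a b : assignment n m) (cs : seq (constraint n m)).

Definition feasible cs a : bool :=
  [forall u, (s_ a u == 0) || (s_ a u == 1)] && all (fun c => c a) cs.

Definition objective a : int := \sum_u s_ a u.

Definition optimal cs a : Prop :=
  feasible cs a /\ forall b, feasible cs b -> objective a <= objective b.

Definition chosen a : {set 'I_n * 'I_m} := [set u | s_ a u == 1].

End Solutions.

(* Main.v *)
(** In the rook graph the distance of [x] and [z] is the number of coordinates
    in which they differ.  Hence two aligned vertices are told apart exactly by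
    the vertices of the two layers they do not share, with weight 1, and the
    vertices [(i, j)], [(i', j')] with [i != i'] and [j != j'] by the vertices of
    the four layers through them: weight 2 at the two vertices themselves, 0 at
    the other two corners of the rectangle, and 1 elsewhere.  Summing over [S],
    constraints (3)-(5) say precisely that [S] is weakly k-resolving.  Adding (3)
    and (4) bounds the left side of (5) below by [2 * k - 4], so (5) is implied
    by them as soon as [4 <= k]. *)
Require Import Defs.
From HB Require Import structures.
From mathcomp Require Import all_boot all_order all_algebra.
From mathcomp Require Import zify.
Set Implicit Arguments.
Unset Strict Implicit.
Unset Printing Implicit Defensive.
Import Order.TTheory GRing.Theory Num.Theory.
Local Open Scope nat_scope.

(** * Distances, unordered pairs and counting in finite types *)

Lemma gdist_eq (T : finType) (e : rel T) (x y : T) (d : nat) :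
  d < #|T| -> has_path e d x y -> (forall l, l < d -> ~~ has_path e l x y) ->
  gdist e x y = d.
Proof.
move=> dT pd npd; rewrite /gdist.
set P := fun l => _.
(* Since [d] lies in the search range, the search succeeds and [gdist] does not take its default
   value; an index in [iota 0 #|T|] is the length it stands for. *)
have hasP : has P (iota 0 #|T|).
  by apply/hasP; exists d => //; rewrite mem_iota.
have fT : find P (iota 0 #|T|) < #|T| by rewrite -{2}(size_iota 0 #|T|) -has_find.
apply/eqP; rewrite eqn_leq; apply/andP; split; rewrite leqNgt; apply/negP => lt.
  by have := before_find 0 lt; rewrite nth_iota // /P pd.
have := nth_find 0 hasP; rewrite nth_iota // add0n /P.
by apply/negP; apply: npd.
Qed.

(** Distinct elements have distinct ranks, so [upairs] lists them in one of the two orders; symmetry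
    of [P] supplies the other. *)
Lemma all_upairs (T : finType) (P : rel T) : symmetric P ->
  all (fun p => P p.1 p.2) (upairs T) <-> (forall x y, x != y -> P x y).
Proof.
move=> symP; split=> [/allP Pup x y xy | Pxy].
  have lt_mem a b : enum_rank a < enum_rank b -> P a b.
    by move=> ab; apply: (Pup (a, b)); rewrite mem_filter /= ab mem_enum.
  case: (ltngtP (enum_rank x) (enum_rank y)) => [/lt_mem //|/lt_mem|eq_r].
    by rewrite symP.
  by move/negP: xy; case; apply/eqP/enum_rank_inj/val_inj.
apply/allP => -[x y]; rewrite mem_filter /= => /andP[lt _].
by apply: Pxy; apply/eqP => xy; rewrite xy ltnn in lt.
Qed.

Lemma size_upairs (T : finType) : size (upairs T) <= #|T| ^ 2.
Proof.
by rewrite -mulnn -card_prod cardE size_filter; apply: count_size.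
Qed.

Lemma sum_nat_mem (T : finType) (S A : {set T}) :
  \sum_(w in S) (w \in A) = #|S :&: A|.
Proof.
rewrite -sum1_card [RHS](eq_bigl (fun w => (w \in S) && (w \in A))).
  by rewrite [RHS]big_mkcondr; apply: eq_bigr => w _; case: (w \in A).
by move=> w; rewrite inE.
Qed.

Lemma cardsI1 (T : finType) (S : {set T}) (p : T) :
  #|S :&: [set p]| = (p \in S).
Proof.
case: (boolP (p \in S)) => pS.
  by rewrite (setIidPr _) ?cards1 ?sub1set.
by rewrite (disjoint_setI0 _) ?cards0 // disjoint_sym disjoints1.
Qed.

(** * Distances and weakly resolving sets in the rook graph *)

Section Rook.

Variables n m : nat.
Hypotheses (n_ge2 : 2 <= n) (m_ge2 : 2 <= m).
Implicit Types (x y z u v w : 'I_n * 'I_m) (S : {set 'I_n * 'I_m}).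

Lemma gdist_rook x y : gdist (rook n m) x y = (x.1 != y.1) + (x.2 != y.2).
Proof.
(* With at least four vertices, the distances 0, 1 and 2 all fall within the search range of
   [gdist]. *)
have cT : 3 < #|{: 'I_n * 'I_m}|.
  by rewrite card_prod !card_ord; apply: (leq_mul n_ge2 m_ge2).
case: x y => [i j] [i' j'] /=.
have no_path0 : (i, j) != (i', j') -> ~~ has_path (rook n m) 0 (i, j) (i', j').
  by move=> neq; apply/existsP => -[p]; rewrite tuple0 /= andbT (negPf neq).
apply: gdist_eq.
- by apply: leq_ltn_trans cT; case: eqP; case: eqP.
- case: (eqVneq i i') => [<-|ii]; case: (eqVneq j j') => [<-|jj] /=;
    apply/existsP.
  + by exists [tuple] => /=; rewrite eqxx.
  + exists [tuple (i, j')] => /=.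
    by rewrite /rook /aligned !inE /= !xpair_eqE !eqxx (negPf jj).
  + exists [tuple (i', j)] => /=.
    by rewrite /rook /aligned !inE /= !xpair_eqE !eqxx (negPf ii).
  + exists [tuple (i', j); (i', j')] => /=.
    by rewrite /rook /aligned !inE /= !xpair_eqE !eqxx (negPf ii) (negPf jj).
- case=> [|[|l]] lt.
  + by apply: no_path0; rewrite xpair_eqE; case: eqP lt; case: eqP.
  (* An edge changes exactly one coordinate, so one edge cannot join vertices that differ in
     both. *)
  + apply/existsP => -[p]; case: p => -[|q [|//]] //= _.
    rewrite /rook /aligned andbT => /and3P[/andP[_ al] /eqP qE _].
    by move: al lt; rewrite qE /=; case: eqP; case: eqP.
  + by move: lt; case: eqP; case: eqP.
Qed.

(** The common coordinate contributes equally to both distances and cancels; as [j != j'], no [w]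
    lies in both layers. *)
Lemma Delta_rook_hor (i : 'I_n) (j j' : 'I_m) w : j != j' ->
  Delta (rook n m) w (i, j) (i, j') = (w \in hlayer n j) + (w \in hlayer n j').
Proof.
case: w => a b jj; rewrite /Delta !gdist_rook !inE /=.
case: (eqVneq j b) jj => [->|_]; case: (eqVneq j' b) => _;
  case: (i == a); by rewrite ?eqxx.
Qed.

Lemma Delta_rook_ver (i i' : 'I_n) (j : 'I_m) w : i != i' ->
  Delta (rook n m) w (i, j) (i', j) = (w \in vlayer m i) + (w \in vlayer m i').
Proof.
case: w => a b ii; rewrite /Delta !gdist_rook !inE /=.
case: (eqVneq i a) ii => [->|_]; case: (eqVneq i' a) => _;
  case: (j == b); by rewrite ?eqxx.
Qed.

(* The corner terms stand on the left so that no truncated subtraction occurs. *)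
Lemma Delta_rook_diag u v w : u.1 != v.1 -> u.2 != v.2 ->
  Delta (rook n m) w u v
    + 2 * (w \in [set (u.1, v.2)]) + 2 * (w \in [set (v.1, u.2)]) =
  (w \in hlayer n u.2) + (w \in hlayer n v.2)
    + (w \in vlayer m u.1) + (w \in vlayer m v.1).
Proof.
case: u v w => [i j] [i' j'] [a b] /= ii jj.
rewrite /Delta !gdist_rook !inE !xpair_eqE /=.
case: (eqVneq i a) ii => [->|_]; case: (eqVneq i' a) => _;
case: (eqVneq j b) jj => [->|_]; case: (eqVneq j' b) => _;
  by rewrite ?eqxx.
Qed.

Definition hlayers_meet (k : nat) S : Prop := forall j j' : 'I_m, j != j' ->
  k <= #|S :&: hlayer n j| + #|S :&: hlayer n j'|.

Definition vlayers_meet (k : nat) S : Prop := forall i i' : 'I_n, i != i' ->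
  k <= #|S :&: vlayer m i| + #|S :&: vlayer m i'|.

(** Constraint (5) over the naturals, with the subtracted corner terms moved to the left. It is
    boolean so that it can serve as a relation for [all_upairs]. *)
Definition diag_meet (k : nat) S u v : bool :=
  k + 2 * ((u.1, v.2) \in S) + 2 * ((v.1, u.2) \in S) <=
  #|S :&: hlayer n u.2| + #|S :&: hlayer n v.2|
    + #|S :&: vlayer m u.1| + #|S :&: vlayer m v.1|.

Definition diags_meet (k : nat) S : Prop :=
  forall u v, u.1 != v.1 -> u.2 != v.2 -> diag_meet k S u v.

(** Each corner term is the size of [S] met with a singleton, so the identity [Delta_rook_diag] can
    be summed over [S]; the corner terms then cancel. *)
Lemma diag_meetE (k : nat) S u v : u.1 != v.1 -> u.2 != v.2 ->
  diag_meet k S u v = (k <= \sum_(w in S) Delta (rook n m) w u v).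
Proof.
move=> ii jj; rewrite /diag_meet -!cardsI1 -!sum_nat_mem -!big_split /=.
under [X in _ <= X]eq_bigr => w _ do rewrite -(Delta_rook_diag w ii jj).
by rewrite !big_split /= !big1_eq !addn0 !addnn !mul2n !leq_add2r.
Qed.

Lemma weak_resolving_rook (k : nat) S :
  weak_resolving (rook n m) k S <->
  [/\ hlayers_meet k S, vlayers_meet k S & diags_meet k S].
Proof.
split=> [/forallP res | [hS vS dS]].
  have {}res u v : u != v -> k <= \sum_(w in S) Delta (rook n m) w u v.
    by move/forallP/(_ v)/implyP: (res u).
  split.
  (* The layer counts do not depend on the shared coordinate, so any value will do; 0 is available
     because [n] is positive. *)
  - move=> j j' jj; pose i := Ordinal (ltnW n_ge2).
    have /res : (i, j) != (i, j') by rewrite xpair_eqE (negPf jj) andbF.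
    under eq_bigr => w _ do rewrite Delta_rook_hor //.
    by rewrite big_split /= !sum_nat_mem.
  - move=> i i' ii; pose j := Ordinal (ltnW m_ge2).
    have /res : (i, j) != (i', j) by rewrite xpair_eqE (negPf ii).
    under eq_bigr => w _ do rewrite Delta_rook_ver //.
    by rewrite big_split /= !sum_nat_mem.
  - move=> u v ii jj; rewrite diag_meetE //; apply: res.
    by apply: contraNneq ii => ->.
apply/forallP => -[i j]; apply/forallP => -[i' j']; apply/implyP.
rewrite xpair_eqE; case: (eqVneq i i') => [<-|ii]; case: (eqVneq j j') => [<-|jj] //= _.
- under eq_bigr => w _ do rewrite Delta_rook_hor //.
  by rewrite big_split /= !sum_nat_mem; apply: hS.
- under eq_bigr => w _ do rewrite Delta_rook_ver //.
  by rewrite big_split /= !sum_nat_mem; apply: vS.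
- by rewrite -diag_meetE //; apply: dS.
Qed.

Lemma diags_meet_ge4 (k : nat) S : 4 <= k ->
  hlayers_meet k S -> vlayers_meet k S -> diags_meet k S.
Proof.
move=> k4 hS vS u v ii jj; have := hS _ _ jj; have := vS _ _ ii.
(* The two corners cost at most 4 together, and [k + 4 <= 2 * k]. *)
rewrite /diag_meet; case: (_ \in S); case: (_ \in S); lia.
Qed.

End Rook.

(** * Feasible assignments as encodings of vertex sets *)

Section Assignments.

Variables n m : nat.
Implicit Types (a : assignment n m) (S : {set 'I_n * 'I_m}).

(** A pointwise relation rather than an equality with [encoding S], since the fields of an
    assignment are functions. *)
Definition encodes a S : Prop :=
  [/\ forall u, s_ a u = Posz (u \in S),
      forall j, h_ a j = Posz #|S :&: hlayer n j|
    & forall i, g_ a i = Posz #|S :&: vlayer m i|].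

Definition encoding S : assignment n m :=
  Assignment (fun u => Posz (u \in S))
    (fun j => Posz #|S :&: hlayer n j|) (fun i => Posz #|S :&: vlayer m i|).

Lemma encodingP S : encodes (encoding S) S.
Proof. by []. Qed.

Lemma encodes_chosen a S : encodes a S -> chosen a = S.
Proof. by case=> sE _ _; apply/setP => u; rewrite inE sE; case: (u \in S). Qed.

Lemma sum_mem_layer (T : finType) (S L : {set T}) :
  (\sum_(u in L) Posz (u \in S))%R = Posz #|S :&: L|.
Proof.
by rewrite setIC -sum_nat_mem -natz natr_sum; apply: eq_bigr => u _; rewrite natz.
Qed.

Lemma objective_encodes a S : encodes a S -> objective a = Posz #|S|.
Proof.
case=> sE _ _; rewrite /objective -[in RHS](setIT S) -sum_mem_layer.
by apply: eq_big => u; rewrite ?inE // => _; rewrite sE.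
Qed.

(** A 0/1-valued [s_] is the indicator of [chosen a], and (1) and (2) then force [h_] and [g_] to be
    the layer counts: the chosen set is the only freedom left. *)
Lemma con12_encodes a :
  feasible (con1 n m ++ con2 n m) a <-> encodes a (chosen a).
Proof.
split.
  rewrite /feasible all_cat [all _ (con1 _ _)]all_map [all _ (con2 _ _)]all_map.
  move=> /andP[/forallP s01 /andP[/allP c1 /allP c2]].
  have sE u : s_ a u = Posz (u \in chosen a).
    by rewrite inE; case/orP: (s01 u) => /eqP ->.
  split=> // [j|i].
    rewrite -sum_mem_layer (eqP (c1 j (mem_enum 'I_m j))).
    by apply: eq_bigr => u _.
  rewrite -sum_mem_layer (eqP (c2 i (mem_enum 'I_n i))).
  by apply: eq_bigr => u _.
move=> [sE hE gE].
rewrite /feasible all_cat [all _ (con1 _ _)]all_map [all _ (con2 _ _)]all_map.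
apply/and3P; split.
- by apply/forallP => u; rewrite sE; case: (u \in _).
- apply/allP => j _ /=; rewrite hE -sum_mem_layer; apply/eqP.
  by apply: eq_bigr => u _.
- apply/allP => i _ /=; rewrite gE -sum_mem_layer; apply/eqP.
  by apply: eq_bigr => u _.
Qed.

Lemma con3_encodes (k : nat) a S : encodes a S ->
  all (fun c => c a) (con3 n m k) <-> hlayers_meet k S.
Proof.
case=> _ hE _; rewrite all_map.
rewrite (eq_all (a2 := fun p : 'I_m * 'I_m =>
  k <= #|S :&: hlayer n p.1| + #|S :&: hlayer n p.2|)); last first.
  by move=> p /=; rewrite !hE -PoszD.
apply: (all_upairs (P := fun j j' =>
  k <= #|S :&: hlayer n j| + #|S :&: hlayer n j'|)).
by move=> j j' /=; rewrite addnC.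
Qed.

Lemma con4_encodes (k : nat) a S : encodes a S ->
  all (fun c => c a) (con4 n m k) <-> vlayers_meet k S.
Proof.
case=> _ _ gE; rewrite all_map.
rewrite (eq_all (a2 := fun p : 'I_n * 'I_n =>
  k <= #|S :&: vlayer m p.1| + #|S :&: vlayer m p.2|)); last first.
  by move=> p /=; rewrite !gE -PoszD.
apply: (all_upairs (P := fun i i' =>
  k <= #|S :&: vlayer m i| + #|S :&: vlayer m i'|)).
by move=> i i' /=; rewrite addnC.
Qed.

Lemma diag_meet_sym (k : nat) S : symmetric (diag_meet k S).
Proof. by move=> u v; rewrite /diag_meet; lia. Qed.

Lemma con5_encodes (k : nat) a S : encodes a S ->
  all (fun c => c a) (con5 n m k) <-> diags_meet k S.
Proof.
case=> sE hE gE; rewrite all_map all_filter.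
(* The filter on non-aligned pairs becomes a premise, so that [all_upairs] applies to a relation on
   all vertices. *)
rewrite (eq_all (a2 := fun p =>
  (fun u v => ~~ aligned u v ==> diag_meet k S u v) p.1 p.2)); last first.
  move=> [u v] /=; rewrite !hE !gE !sE /diag_meet; congr (_ ==> _).
  by case: (_ \in S); case: (_ \in S); lia.
have symP : symmetric (fun u v => ~~ aligned u v ==> diag_meet k S u v).
  move=> u v /=; rewrite diag_meet_sym /aligned.
  by rewrite (eq_sym u.1) (eq_sym u.2).
split=> [/(all_upairs symP) dS u v ii jj | dS].
  have uv : u != v by apply: contraNneq ii => ->.
  by move/implyP: (dS u v uv); apply; rewrite /aligned (negPf ii) (negPf jj).
(* For distinct vertices, not being aligned means differing in both coordinates. *)
apply/(all_upairs symP) => -[i j] [i' j']; rewrite xpair_eqE /aligned /=.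
case: (eqVneq i i') => // ii; case: (eqVneq j j') => //= jj _.
exact: dS.
Qed.

Lemma feasible_cat (cs cs' : seq (constraint n m)) a :
  feasible (cs ++ cs') a = feasible cs a && all (fun c => c a) cs'.
Proof. by rewrite /feasible all_cat andbA. Qed.

Lemma feasible_without5P (k : nat) a :
  feasible (F_gh_without5 n m k) a <->
  [/\ encodes a (chosen a), hlayers_meet k (chosen a)
    & vlayers_meet k (chosen a)].
Proof.
rewrite /F_gh_without5 catA feasible_cat all_cat; split.
  move=> /and3P[/con12_encodes enc c3 c4].
  by split=> //; [apply/(con3_encodes k enc) | apply/(con4_encodes k enc)].
move=> [enc hS vS]; apply/and3P; split; first exact/con12_encodes.
  exact/(con3_encodes k enc).
exact/(con4_encodes k enc).
Qed.

Lemma feasible_F_ghP (k : nat) a :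
  feasible (F_gh n m k) a <->
  feasible (F_gh_without5 n m k) a /\ diags_meet k (chosen a).
Proof.
have -> : F_gh n m k = F_gh_without5 n m k ++ con5 n m k.
  by rewrite /F_gh /F_gh_without5 -!catA.
rewrite feasible_cat; split=> [/andP[fa c5] | [fa dS]].
  by split=> //; have /feasible_without5P[enc _ _] := fa; apply/(con5_encodes k enc).
rewrite fa /=; have /feasible_without5P[enc _ _] := fa.
exact/(con5_encodes k enc).
Qed.

Lemma feasible_resolvingP (k : nat) a : 2 <= n -> 2 <= m ->
  feasible (F_gh n m k) a <->
  encodes a (chosen a) /\ weak_resolving (rook n m) k (chosen a).
Proof.
move=> n2 m2; split.
  move=> /feasible_F_ghP[/feasible_without5P[enc hS vS] dS].
  by split=> //; apply/weak_resolving_rook.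
move=> [enc /(weak_resolving_rook n2 m2)[hS vS dS]].
by apply/feasible_F_ghP; split=> //; apply/feasible_without5P.
Qed.

End Assignments.

(** * Weak bases, optimal solutions and the final statement *)

Lemma weak_resolving_leq (T : finType) (e : rel T) (k l : nat) (S : {set T}) :
  k <= l -> weak_resolving e l S -> weak_resolving e k S.
Proof.
move=> kl /forallP res; apply/forallP => x; apply/forallP => y; apply/implyP => xy.
by apply: leq_trans kl _; move/forallP/(_ y)/implyP: (res x); apply.
Qed.

(** A set attaining [kappa] also resolves for every smaller [k], so a resolving set of least size
    exists. *)
Lemma exists_weak_basis (T : finType) (e : rel T) (k : nat) :
  1 < #|T| -> k <= kappa e -> exists S, weak_basis e k S.
Proof.
move=> T1 kk; have [[S0 res0] _] := kappaP e T1.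
have {}res0 := weak_resolving_leq kk res0.
by case: (arg_minnP (fun S : {set T} => #|S|) res0) => S res minS; exists S.
Qed.

(** The objective of a feasible assignment is the size of its chosen set, and [encoding] turns every
    competing resolving set into a competing feasible assignment. *)
Lemma optimalP (n m k : nat) (a : assignment n m) : 2 <= n -> 2 <= m ->
  optimal (F_gh n m k) a <->
  encodes a (chosen a) /\ weak_basis (rook n m) k (chosen a).
Proof.
move=> n2 m2; split.
  move=> [/(feasible_resolvingP k a n2 m2)[enc res] opt].
  split=> //; split=> // S resS; rewrite -lez_nat.
  rewrite -(objective_encodes enc) -(objective_encodes (encodingP S)).
  apply/opt/(feasible_resolvingP _ _ n2 m2).
  by rewrite (encodes_chosen (encodingP S)).
move=> [enc [res minS]]; split; first exact/(feasible_resolvingP _ _ n2 m2).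
move=> b /(feasible_resolvingP k b n2 m2)[encb resb].
by rewrite (objective_encodes enc) (objective_encodes encb) lez_nat; apply: minS.
Qed.

Theorem corollary4p3 :
  exists C3 C4 C5 : nat,
  forall n m k : nat, 2 <= n -> 2 <= m -> 1 <= k <= kappa (rook n m) ->
  (* (a) *)
  ((exists a : assignment n m, optimal (F_gh n m k) a) /\
   (forall a : assignment n m,
      optimal (F_gh n m k) a -> weak_basis (rook n m) k (chosen a))) /\
  (* (b) *)
  (size (con1 n m) = m /\ size (con2 n m) = n /\
   size (con3 n m k) <= C3 * m ^ 2 /\ size (con4 n m k) <= C4 * n ^ 2 /\
   size (con5 n m k) <= C5 * (n ^ 2 * m ^ 2) /\
   (4 <= k -> forall a : assignment n m,
      feasible (F_gh_without5 n m k) a <-> feasible (F_gh n m k) a)) /\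
  (* (c) *)
  (4 <= k -> forall S : {set 'I_n * 'I_m},
     (exists a : assignment n m, feasible (F_gh n m k) a /\ chosen a = S) <->
     (forall i i' : 'I_n, i != i' ->
        k <= #|S :&: vlayer m i| + #|S :&: vlayer m i'|) /\
     (forall j j' : 'I_m, j != j' ->
        k <= #|S :&: hlayer n j| + #|S :&: hlayer n j'|)).
Proof.
exists 1, 1, 1 => n m k n2 m2 /andP[_ k_kappa].
have without5 : 4 <= k -> forall a : assignment n m,
    feasible (F_gh_without5 n m k) a <-> feasible (F_gh n m k) a.
  move=> k4 a; split=> [fa | /feasible_F_ghP[]//].
  have /feasible_without5P[_ hS vS] := fa.
  by apply/feasible_F_ghP; split=> //; apply: diags_meet_ge4.
split; [split | split].
- have cT : 1 < #|{: 'I_n * 'I_m}|.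
    by rewrite card_prod !card_ord; apply: leq_trans (leq_mul n2 m2).
  have [S basS] := exists_weak_basis cT k_kappa.
  exists (encoding S); apply/(optimalP _ _ n2 m2).
  by rewrite (encodes_chosen (encodingP S)).
- by move=> a /(optimalP _ _ n2 m2)[].
- rewrite [size (con1 _ _)]size_map [size (con2 _ _)]size_map !size_enum_ord.
  rewrite [size (con3 _ _ _)]size_map [size (con4 _ _ _)]size_map.
  rewrite [size (con5 _ _ _)]size_map !mul1n.
  do 2!split=> //; split; [|split; [|split=> //]].
  + by rewrite -[X in _ <= X ^ 2]card_ord size_upairs.
  + by rewrite -[X in _ <= X ^ 2]card_ord size_upairs.
  (* The pairs in (5) are filtered from [upairs] on the [n * m] vertices, hence number at most
     [(n * m) ^ 2]. *)
  + rewrite -expnMn -[X in (X * _) ^ 2]card_ord -[X in (_ * X) ^ 2]card_ord.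
    rewrite -card_prod; apply: leq_trans (size_upairs _).
    by rewrite size_filter count_size.
- move=> k4 S; split=> [[a [/(without5 k4)/feasible_without5P[_ hS vS] <-]] | [vS hS]].
    by split.
  (* Encoding [S] settles (1) and (2); the layer conditions are (3) and (4), and (5) follows from
     [4 <= k]. *)
  exists (encoding S); have chS := encodes_chosen (encodingP S); split=> //.
  by apply/(without5 k4)/feasible_without5P; rewrite chS.
Qed.
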